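(* Let $X=\ell^2$ and $R(x)=\|x\|_{\ell^1}=\sum_k|x_k|$ (with value $+\infty$ if the sum diverges). Assume that $x^\dagger$ is finitely supported, that there is $w\in Y$ with $K^*w\in\partial R(x^\dagger)$, and that $K$ has the finite basis injectivity property: for all finitely supported $u,v\in\ell^2$, $Ku=Kv$ implies $u=v$. For every $\delta_0>0$ there exists a constant $C>0$ such that the following holds for all $\delta\in(0,\delta_0]$ and all $y^\delta\in Y$ with $\|y^\dagger-y^\delta\|\le\delta$. Let $\phi(\alpha)=\|Kx_\alpha^\delta-y^\delta\|^2/\alpha$, and let $\alpha^*\in(0,\|K\|^2]$ satisfy $\phi(\alpha^* )\le\phi(\alpha)$ for all $\alpha\in(0,\|K\|^2]$. If $\delta^*:=\|Kx_{\alpha^*}^\delta-y^\delta\|\neq0$, then $$\|x^\dagger-x_{\alpha^*}^\delta\|_{\ell^1}\le C\Bigl(1+\bigl(\tfrac{\delta}{\delta^*}\bigr)^2\Bigr)\max(\delta^*,\delta).$$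
   Context: $Y$ is a real Hilbert space, $\ell^2$ is the real sequence space, $K:\ell^2\to Y$ is a bounded linear operator with adjoint $K^*$. The exact data $y^\dagger$ lie in the range of $K$. For $\alpha>0$ and noisy data $y^\delta\in Y$, $x_\alpha^\delta$ denotes a minimizer over $x\in \ell^2$ of $\tfrac12\|Kx-y^\delta\|^2+\alpha R(x)$ (any choice of minimizers is allowed). $x^\dagger$ is an $R$-minimum solution: $Kx^\dagger=y^\dagger$ and $R(x^\dagger)=\min\{R(x): Kx=y^\dagger\}<\infty$. $\partial R(x)$ is the subdifferential of the convex functional $R:\ell^2\to[0,\infty]$. *)

(* Defs.v *)
From HB Require Import structures.
From mathcomp Require Import all_boot all_order all_algebra.
From mathcomp Require Import all_classical all_reals all_analysis.
From mathcomp Require Import ring lra.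

Set Implicit Arguments.
Unset Strict Implicit.
Unset Printing Implicit Defensive.

Import Order.TTheory GRing.Theory Num.Theory.
Import numFieldNormedType.Exports.

Local Open Scope classical_set_scope.
Local Open Scope ring_scope.

HB.mixin Record NormedModule_isInnerProduct (R : realType) V
    & NormedModule R V := {
  inner : V -> V -> R ;
  innerC : forall u v, inner u v = inner v u ;
  innerPl : forall (a : R) u v w,
    inner (a *: u + v) w = a * inner u w + inner v w ;
  innerE : forall u, inner u u = `|u| ^+ 2
}.

#[short(type="innerProductType")]
HB.structure Definition InnerProduct (R : realType) :=
  {V of NormedModule_isInnerProduct R V & NormedModule R V}.

#[short(type="hilbertType")]
HB.structure Definition Hilbert (R : realType) :=
  {V of InnerProduct R V & CompleteNormedModule R V}.

Notation "<[ u , v ]>" := (inner u v)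
  (format "<[ u ,  v ]>") : ring_scope.

Section inner_theory.
Context {R : realType} {V : innerProductType R}.
Implicit Types (u v w : V) (a : R).

Lemma innerDl u v w : <[ u + v, w ]> = <[ u, w ]> + <[ v, w ]>.
Proof. by have := innerPl 1 u v w; rewrite scale1r mul1r. Qed.

Lemma inner0l w : <[ 0 : V, w ]> = 0.
Proof. by have := innerDl 0 0 w; rewrite addr0; lra. Qed.

Lemma innerZl a u w : <[ a *: u, w ]> = a * <[ u, w ]>.
Proof. by have := innerPl a u 0 w; rewrite addr0 inner0l addr0. Qed.

Lemma innerNl u w : <[ - u, w ]> = - <[ u, w ]>.
Proof. by rewrite -scaleN1r innerZl mulN1r. Qed.

Lemma innerBl u v w : <[ u - v, w ]> = <[ u, w ]> - <[ v, w ]>.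
Proof. by rewrite innerDl innerNl. Qed.

Lemma innerDr w u v : <[ w, u + v ]> = <[ w, u ]> + <[ w, v ]>.
Proof. by rewrite !(innerC w) innerDl. Qed.

Lemma innerZr a w u : <[ w, a *: u ]> = a * <[ w, u ]>.
Proof. by rewrite !(innerC w) innerZl. Qed.

Lemma innerBr w u v : <[ w, u - v ]> = <[ w, u ]> - <[ w, v ]>.
Proof. by rewrite !(innerC w) innerBl. Qed.

Lemma inner_suml (I : Type) (r : seq I) (P : pred I) (F : I -> V) w :
  <[ \sum_(i <- r | P i) F i, w ]> = \sum_(i <- r | P i) <[ F i, w ]>.
Proof.
exact: (big_morph (fun x : V => <[ x, w ]>)
  (fun x y => innerDl x y w) (inner0l w)).
Qed.

End inner_theory.

(* Cauchy-Schwarz for a symmetric positive definite form, stated before any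
   norm is available so that it can be used to build the norm of ell2. *)
Lemma form_CauchySchwarz (R : realType) (V : lmodType R) (b : V -> V -> R) :
  (forall u v, b u v = b v u) ->
  (forall (a : R) u v w, b (a *: u + v) w = a * b u w + b v w) ->
  (forall u, 0 <= b u u) -> (forall u, b u u = 0 -> u = 0) ->
  forall u v, b u v ^+ 2 <= b u u * b v v.
Proof.
move=> bC bP b_ge0 b_eq0 u v.
have b0 w : b 0 w = 0.
  by have := bP 1 0 0 w; rewrite scale1r addr0 mul1r; lra.
have bZ a x w : b (a *: x) w = a * b x w.
  by have := bP a x 0 w; rewrite addr0 b0 addr0.
have [v0|v0] := eqVneq (b v v) 0.
  by rewrite v0 mulr0 (b_eq0 _ v0) bC b0 expr0n.
have v_gt0 : 0 < b v v by rewrite lt_neqAle eq_sym v0 b_ge0.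
have := b_ge0 (b v v *: u + (- b u v) *: v).
rewrite bP bZ !(bC _ (_ + _)) !bP !bZ (bC v u) => h.
have {}h : 0 <= b v v * (b u u * b v v - b u v ^+ 2).
  by apply: le_trans h _; rewrite le_eqVlt; apply/orP; left; apply/eqP; ring.
by rewrite pmulr_rge0// subr_ge0 in h.
Qed.

Lemma inner_CauchySchwarz (R : realType) (V : innerProductType R) (u v : V) :
  `|<[ u, v ]>| <= `|u| * `|v|.
Proof.
rewrite -(@ler_pXn2r _ 2)// ?nnegrE ?mulr_ge0// real_normK ?num_real// exprMn.
rewrite -!innerE; apply: form_CauchySchwarz.
- exact: innerC.
- exact: innerPl.
- by move=> w; rewrite innerE sqr_ge0.
- by move=> w; rewrite innerE => /eqP; rewrite sqrf_eq0 normr_eq0 => /eqP.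
Qed.

Section square_summable.
Context {R : realType}.

Definition square_summable : {pred (nat -> R)} :=
  [pred u : nat -> R | `[< cvgn (series (fun k => u k ^+ 2)) >]].

Lemma square_summableP (u : nat -> R) :
  reflect (cvgn (series (fun k => u k ^+ 2))) (u \in square_summable).
Proof. exact: asboolP. Qed.

Lemma square_summable_le (u : nat -> R) (M : R) :
  (forall n, \sum_(0 <= k < n) u k ^+ 2 <= M) ->
  u \in square_summable /\ limn (series (fun k => u k ^+ 2)) <= M.
Proof.
move=> uM; have cu : cvgn (series (fun k => u k ^+ 2)).
  apply: nondecreasing_is_cvgn.
    by apply: nondecreasing_series => n _ _; exact: sqr_ge0.
  by exists M => _ [n _ <-]; exact: uM.
split; first exact/square_summableP.
by apply: limr_le => //; near=> n; exact: uM.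
Unshelve. all: by end_near. Qed.

Lemma square_summable_sum_le (u : nat -> R) n : u \in square_summable ->
  \sum_(0 <= k < n) u k ^+ 2 <= limn (series (fun k => u k ^+ 2)).
Proof.
move=> /square_summableP cu; apply: (nondecreasing_cvgn_le _ cu).
by apply: nondecreasing_series => k _ _; exact: sqr_ge0.
Qed.

Lemma square_summable_submod : submod_closed square_summable.
Proof.
split=> [|a u v /square_summableP cu /square_summableP cv].
  suff /square_summable_le[] :
      forall n, \sum_(0 <= k < n) (0 : nat -> R) k ^+ 2 <= 0 by [].
  by move=> n; rewrite big1// => k _; rewrite expr0n.
apply/square_summableP.
have c2 : cvgn (series ((2 * a ^+ 2) *: (fun k => u k ^+ 2)
                        + 2 *: (fun k => v k ^+ 2))).
  by apply: is_cvg_seriesD; exact: is_cvg_seriesZ.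
apply: (series_le_cvg _ _ _ c2) => n.
- exact: sqr_ge0.
- rewrite /= /GRing.scale/= addr_ge0// mulr_ge0 ?sqr_ge0//.
  by rewrite mulr_ge0// sqr_ge0.
- rewrite -[leLHS]/((a * u n + v n) ^+ 2).
  rewrite -[leRHS]/((2 * a ^+ 2) * u n ^+ 2 + 2 * v n ^+ 2).
  by have := sqr_ge0 (a * u n - v n); nra.
Qed.

HB.instance Definition _ :=
  GRing.isSubmodClosed.Build R (nat -> R) square_summable
    square_summable_submod.

End square_summable.

Record ell2 (R : realType) := Ell2 {
  ell2_val :> nat -> R ;
  ell2_valP : ell2_val \in square_summable }.

HB.instance Definition _ (R : realType) := [isSub for @ell2_val R].
HB.instance Definition _ (R : realType) := [Choice of ell2 R by <:].
HB.instance Definition _ (R : realType) :=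
  [SubChoice_isSubLmodule of ell2 R by <:].

Section ell2_inner.
Context {R : realType}.
Implicit Types (u v w : ell2 R) (a : R).

Lemma ell2DE u v k : (u + v) k = u k + v k. Proof. by []. Qed.
Lemma ell2NE u k : (- u) k = - u k. Proof. by []. Qed.
Lemma ell2BE u v k : (u - v) k = u k - v k. Proof. by []. Qed.
Lemma ell2ZE a u k : (a *: u) k = a * u k. Proof. by []. Qed.
Lemma ell20E k : (0 : ell2 R) k = 0. Proof. by []. Qed.

Lemma ell2P u v : u =1 v -> u = v.
Proof. by move=> uv; exact/val_inj/funext. Qed.

Definition ell2_inner u v : R := limn (series (fun k => u k * v k)).

Definition ell2_norm u : R := Num.sqrt (limn (series (fun k => u k ^+ 2))).

Lemma is_cvg_ell2_inner u v : cvgn (series (fun k => u k * v k)).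
Proof.
apply: normed_cvg.
have /square_summableP cu := ell2_valP u.
have /square_summableP cv := ell2_valP v.
apply: (series_le_cvg _ _ _ (is_cvg_seriesD cu cv)) => n /=.
- exact: normr_ge0.
- by rewrite addr_ge0 ?sqr_ge0.
- rewrite -[leRHS]/(u n ^+ 2 + v n ^+ 2) normrM.
  rewrite -(real_normK (num_real (u n))) -(real_normK (num_real (v n))).
  have := sqr_ge0 (`|u n| - `|v n|); have := normr_ge0 (u n).
  have := normr_ge0 (v n); nra.
Qed.

Lemma ell2_innerC u v : ell2_inner u v = ell2_inner v u.
Proof.
by rewrite /ell2_inner; under eq_fun do rewrite mulrC.
Qed.

Lemma ell2_innerPl a u v w :
  ell2_inner (a *: u + v) w = a * ell2_inner u w + ell2_inner v w.
Proof.
have cu := @is_cvg_ell2_inner u w; have cv := @is_cvg_ell2_inner v w.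
rewrite /ell2_inner.
rewrite -[a * _]/(a *: _) -(lim_seriesZ _ cu) -(lim_seriesD _ cv); last first.
  exact: is_cvg_seriesZ.
congr (limn (series _)); apply/funext => k.
by rewrite ell2DE ell2ZE mulrDl -mulrA.
Qed.

Lemma ell2_innerE u :
  ell2_inner u u = limn (series (fun k => u k ^+ 2)).
Proof. by []. Qed.

Lemma ell2_inner_ge0 u : 0 <= ell2_inner u u.
Proof.
rewrite ell2_innerE; have := square_summable_sum_le 0 (ell2_valP u).
by rewrite big_nil.
Qed.

Lemma ell2_norm_sqr u : ell2_norm u ^+ 2 = ell2_inner u u.
Proof. by rewrite sqr_sqrtr// ell2_inner_ge0. Qed.

Lemma ell2_norm_ge0 u : 0 <= ell2_norm u. Proof. exact: sqrtr_ge0. Qed.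

Lemma ell2_inner_eq0 u : ell2_inner u u = 0 -> u = 0.
Proof.
move=> u0; apply: ell2P => k; rewrite ell20E; apply/eqP.
rewrite -sqrf_eq0 eq_le sqr_ge0 andbT.
have := square_summable_sum_le k.+1 (ell2_valP u).
rewrite -ell2_innerE u0; apply: le_trans.
rewrite big_nat_recr//= lerDr.
by apply: sumr_ge0 => i _; exact: sqr_ge0.
Qed.

Lemma ell2_ler_normD u v : ell2_norm (u + v) <= ell2_norm u + ell2_norm v.
Proof.
have := form_CauchySchwarz ell2_innerC ell2_innerPl ell2_inner_ge0
  ell2_inner_eq0 u v.
rewrite -!ell2_norm_sqr -exprMn => cs.
have {}cs : ell2_inner u v <= ell2_norm u * ell2_norm v.
  apply: le_trans (ler_norm _) _.
  rewrite -(@ler_pXn2r _ 2)// ?nnegrE ?mulr_ge0 ?ell2_norm_ge0//.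
  by rewrite real_normK ?num_real.
rewrite -(@ler_pXn2r _ 2)// ?nnegrE ?addr_ge0 ?ell2_norm_ge0//.
rewrite ell2_norm_sqr -[u]scale1r ell2_innerPl scale1r !(ell2_innerC _ (_ + _)).
rewrite -[u]scale1r !ell2_innerPl scale1r -!ell2_norm_sqr (ell2_innerC v u).
by lra.
Qed.

Lemma ell2_normZ a u : ell2_norm (a *: u) = `|a| * ell2_norm u.
Proof.
have e : ell2_norm (a *: u) ^+ 2 = (`|a| * ell2_norm u) ^+ 2.
  rewrite exprMn real_normK ?num_real// !ell2_norm_sqr.
  have z w : ell2_inner 0 w = 0.
    by have := ell2_innerPl 1 0 0 w; rewrite scale1r addr0 mul1r; lra.
  have zl b x w : ell2_inner (b *: x) w = b * ell2_inner x w.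
    by have := ell2_innerPl b x 0 w; rewrite addr0 z addr0.
  by rewrite zl ell2_innerC zl mulrA.
apply/eqP; rewrite -(@eqrXn2 _ 2)// ?ell2_norm_ge0 ?mulr_ge0 ?ell2_norm_ge0//.
exact/eqP.
Qed.

Lemma ell2_norm_eq0 u : ell2_norm u = 0 -> u = 0.
Proof. by move=> u0; apply: ell2_inner_eq0; rewrite -ell2_norm_sqr u0 expr0n. Qed.

HB.instance Definition _ := Lmodule_isNormed.Build R (ell2 R)
  ell2_ler_normD ell2_normZ ell2_norm_eq0.

Lemma ell2_innerE_norm u : ell2_inner u u = `|u| ^+ 2.
Proof. by rewrite -ell2_norm_sqr. Qed.

HB.instance Definition _ := NormedModule_isInnerProduct.Build R (ell2 R)
  ell2_innerC ell2_innerPl ell2_innerE_norm.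

Lemma ell2_sum_le_norm u n : \sum_(0 <= k < n) u k ^+ 2 <= `|u| ^+ 2.
Proof. by rewrite -ell2_innerE_norm; exact/square_summable_sum_le/ell2_valP. Qed.

Lemma ell2_coord_le u k : `|u k| <= `|u|.
Proof.
rewrite -(@ler_pXn2r _ 2)// ?nnegrE// real_normK ?num_real//.
apply: le_trans (ell2_sum_le_norm u k.+1).
rewrite big_nat_recr//= lerDr.
by apply: sumr_ge0 => i _; exact: sqr_ge0.
Qed.

Lemma ell2_cauchy_cvg (F : set_system (ell2 R)) :
  ProperFilter F -> cauchy F -> cvg F.
Proof.
move=> FF Fc.
have Fe e : 0 < e -> exists2 x : ell2 R, F (ball x e) & True.
  by move=> e0; have /cauchyP /(_ _ e0)[x Fx] := Fc; exists x.
have Fk k : cvg ((fun u : ell2 R => u k) @ F).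
  apply/cauchy_cvgP/cauchyP => e e0.
  have [x Fx _] := Fe e e0; exists (x k).
  rewrite /fmap/=; apply: filterS Fx => y; rewrite -!ball_normE/=.
  by apply: le_lt_trans; rewrite -ell2BE ell2_coord_le.
pose a k : R := lim ((fun u : ell2 R => u k) @ F).
have aB e (x : ell2 R) : 0 < e -> F (ball x e) ->
    forall n, \sum_(0 <= k < n) ((x k - a k) ^+ 2) <= e ^+ 2.
  move=> e0 Fx n.
  have cvs : (fun u : ell2 R => \sum_(0 <= k < n) (x k - u k) ^+ 2) @ F -->
      (\sum_(0 <= k < n) (x k - a k) ^+ 2).
    elim: n => [|n ih].
      by rewrite big_nil; under eq_fun do rewrite big_nil; exact: cvg_cst.
    rewrite big_nat_recr//=; under eq_fun do rewrite big_nat_recr//=.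
    apply: cvgD => //; under eq_fun do rewrite expr2; rewrite expr2.
    by apply: cvgM; apply: cvgB (Fk n); exact: cvg_cst.
  rewrite -(cvg_lim _ cvs)//; apply: limr_le; first exact: cvgP cvs.
  near=> y; apply: le_trans (ell2_sum_le_norm (x - y) n) _.
  rewrite ler_pXn2r ?nnegrE ?(ltW e0)//; apply/ltW.
  have : ball x e y by near: y.
  by rewrite -ball_normE.
have [x1 Fx1 _] := Fe 1 ltr01.
have [xa _] := square_summable_le (aB 1 x1 ltr01 Fx1).
have aS : a \in square_summable.
  rewrite (_ : a = ell2_val x1 - (fun k => x1 k - a k)).
    by rewrite rpredB// ell2_valP.
  by apply/funext => k; rewrite -[RHS]/(x1 k - (x1 k - a k)); ring.
apply/cvg_ex; exists (Ell2 aS); apply/fcvgrPdist_lt => e e0.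
have e3 : 0 < e / 3 by rewrite divr_gt0.
have [x Fx _] := Fe _ e3.
near=> y.
have xy : `|x - y| < e / 3.
  by have : ball x (e / 3) y by [near: y]; rewrite -ball_normE.
have xaN : `|x - Ell2 aS| <= e / 3.
  rewrite -(@ler_pXn2r _ 2)// ?nnegrE ?(ltW e3)// -ell2_innerE_norm.
  have [_] := square_summable_le (aB _ x e3 Fx); exact.
rewrite -(subrKA x); apply: le_lt_trans (ler_normD _ _) _.
by rewrite distrC; lra.
Unshelve. all: by end_near. Qed.

HB.instance Definition _ := Uniform_isComplete.Build (ell2 R) ell2_cauchy_cvg.

End ell2_inner.


Definition bounded_operator (R : realType) (V W : normedModType R)
  (f : V -> W) := exists M : R, forall x, `|f x| <= M * `|x|.

(* Meaningful for bounded operators, where the set is bounded above. *)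
Definition opnorm (R : realType) (V W : normedModType R) (f : V -> W) : R :=
  sup [set `|f x| | x in [set x : V | `|x| <= 1]].

(* The Hilbert space adjoint, picked by its characteristic identity, which
   determines it uniquely; ell2_adjointP below shows that the identity holds
   for every bounded linear operator defined on ell2. *)
Definition adjoint (R : realType) (V W : innerProductType R) (f : V -> W)
    (y : W) : V :=
  xget 0 [set z : V | forall x : V, <[ f x, y ]> = <[ x, z ]>].

Section variational.
Context {R : realType}.
Local Open Scope ereal_scope.

Definition is_minimizer (T : Type) (J : T -> \bar R) (x : T) :=
  forall z, J x <= J z.

(* The dual of V is identified with V by the inner product.  The set is empty
   outside of the effective domain of J. *)
Definition subdifferential (V : innerProductType R) (J : V -> \bar R)
    (x : V) : set V :=
  [set xi | J x \is a fin_num /\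
            forall z, J x + <[ xi, z - x ]>%:E <= J z].

Definition min_solution (V W : normedModType R) (K : V -> W)
    (J : V -> \bar R) (y : W) (x : V) :=
  [/\ K x = y, J x < +oo & forall z, K z = y -> J x <= J z].

Definition tikhonov (V W : normedModType R) (K : V -> W)
    (J : V -> \bar R) (y : W) (alpha : R) (x : V) : \bar R :=
  (2^-1 * `|K x - y| ^+ 2)%:E + alpha%:E * J x.

Definition l1norm (x : ell2 R) : \bar R := \sum_(0 <= k <oo) (`|x k|)%:E.

End variational.

Definition finitely_supported (R : realType) (x : ell2 R) :=
  finite_set [set k | x k != 0].

Definition finite_basis_injective (R : realType) (T : Type)
    (K : ell2 R -> T) :=
  forall u v, finitely_supported u -> finitely_supported v ->
    K u = K v -> u = v.

Section ell2_adjoint.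
Context {R : realType} {Y : innerProductType R} (K : {linear ell2 R -> Y})
  (K_bounded : bounded_operator K).

Let delta_summable (n : nat) :
  (fun k => (k == n)%:R) \in @square_summable R.
Proof.
suff /square_summable_le[] : forall m,
    \sum_(0 <= k < m) ((fun k => (k == n)%:R) k : R) ^+ 2 <= 1 by [].
elim=> [|m ih]; first by rewrite big_nil.
have [mn|mn] := eqVneq m n; last first.
  by rewrite big_nat_recr//= (negPf mn) expr0n addr0.
rewrite big_nat_recr//= mn eqxx expr1n big1_seq ?add0r// => k /=.
rewrite mem_index_iota => /andP[_ kn].
by rewrite (ltn_eqF kn) expr0n.
Qed.

Let delta n : ell2 R := Ell2 (delta_summable n).

Let inner_delta (x : ell2 R) n : <[ x, delta n ]> = x n.
Proof.
rewrite -[LHS]/(limn (series (fun k => x k * (k == n)%:R))).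
apply: cvg_lim => //; apply: cvg_near_cst; near=> m.
have nm : (n < m)%N by near: m; exact: nbhs_infty_gt.
rewrite /series/= (bigD1_seq n) ?iota_uniq//=; last first.
  by rewrite mem_index_iota.
rewrite eqxx mulr1 big1 ?addr0// => k kn.
by rewrite (negPf kn) mulr0.
Unshelve. all: by end_near. Qed.

Let trunc (c : nat -> R) n : ell2 R := \sum_(0 <= k < n) c k *: delta k.

Let inner_trunc c n (x : ell2 R) :
  <[ trunc c n, x ]> = \sum_(0 <= k < n) c k * x k.
Proof.
rewrite inner_suml; apply: eq_bigr => k _.
by rewrite innerZl innerC inner_delta.
Qed.

Let trunc_coord c n k : trunc c n k = if (k < n)%N then c k else 0.
Proof.
rewrite -inner_delta inner_trunc; have [kn|nk] := ltnP k n.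
  rewrite (bigD1_seq k) ?iota_uniq//=; last by rewrite mem_index_iota.
  rewrite eqxx mulr1 big1 ?addr0// => i ik.
  by rewrite (negPf ik) mulr0.
rewrite big1_seq// => i /=; rewrite mem_index_iota => /andP[_ ik].
by rewrite (ltn_eqF (leq_trans ik nk)) mulr0.
Qed.

Let inner_trunc2 c n :
  <[ trunc c n, trunc c n ]> = \sum_(0 <= k < n) c k ^+ 2.
Proof.
rewrite inner_trunc; apply: eq_big_nat => k /andP[_ kn].
by rewrite trunc_coord kn expr2.
Qed.

Lemma ell2_adjoint_exists (y : Y) :
  exists z : ell2 R, forall x, <[ K x, y ]> = <[ x, z ]>.
Proof.
have [M KM] := K_bounded.
pose c k := <[ K (delta k), y ]>.
pose f (x : ell2 R) := <[ K x, y ]>.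
have fM x : `|f x| <= (`|M| * `|y|) * `|x|.
  apply: le_trans (inner_CauchySchwarz _ _) _.
  rewrite mulrAC ler_wpM2r//; apply: le_trans (KM x) _.
  by rewrite ler_wpM2r// ler_norm.
have ftrunc (d : nat -> R) n :
    f (trunc d n) = \sum_(0 <= k < n) d k * c k.
  rewrite /f /trunc linear_sum inner_suml.
  by apply: eq_bigr => k _; rewrite linearZ/= innerZl.
have cB n : \sum_(0 <= k < n) c k ^+ 2 <= (`|M| * `|y|) ^+ 2.
  have := fM (trunc c n); rewrite ftrunc.
  under eq_bigr do rewrite -expr2.
  rewrite -inner_trunc2 innerE ger0_norm ?sqr_ge0//.
  have [->|t0] := eqVneq (trunc c n) 0.
    by rewrite normr0 expr0n sqr_ge0.
  rewrite [leLHS]expr2 ler_pM2r ?normr_gt0// => h.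
  by rewrite ler_pXn2r ?nnegrE ?mulr_ge0.
have [cS _] := square_summable_le cB.
exists (Ell2 cS) => x.
have tr0 : `|x - trunc x n|%R @[n --> \oo] --> (0 : R).
  have e n : `|x - trunc x n| =
      Num.sqrt (`|x| ^+ 2 - \sum_(0 <= k < n) x k ^+ 2).
    apply/esym; rewrite -[RHS]ger0_norm// -sqrtr_sqr; congr Num.sqrt.
    rewrite -!innerE innerBl !innerBr inner_trunc2 (innerC x) inner_trunc.
    under [in RHS]eq_bigr do rewrite -expr2.
    by ring.
  under eq_fun do rewrite e.
  have sq : \sum_(0 <= k < n) x k ^+ 2 @[n --> \oo] --> `|x| ^+ 2.
    rewrite -ell2_innerE_norm.
    exact: (elimT (square_summableP x) (ell2_valP x)).
  have dq : `|x| ^+ 2 - \sum_(0 <= k < n) x k ^+ 2 @[n --> \oo] -->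
      `|x| ^+ 2 - `|x| ^+ 2 by apply: cvgB sq; exact: cvg_cst.
  have : Num.sqrt (`|x| ^+ 2 - \sum_(0 <= k < n) x k ^+ 2) @[n --> \oo] -->
      Num.sqrt (`|x| ^+ 2 - `|x| ^+ 2).
    by apply: continuous_cvg => //; exact: sqrt_continuous.
  by rewrite subrr sqrtr0.
have h1 : f (trunc x n) @[n --> \oo] --> f x.
  apply/cvgrPdist_le => e e0.
  have : (`|M| * `|y|) * `|x - trunc x n|%R @[n --> \oo] --> (0 : R).
    by rewrite -(mulr0 (`|M| * `|y|)); apply: cvgM tr0; exact: cvg_cst.
  move=> /cvgrPdist_le/(_ e e0); apply: filterS => n.
  rewrite sub0r normrN ger0_norm ?mulr_ge0//; apply: le_trans.
  by rewrite (le_trans _ (fM _))// /f linearB innerBl.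
have h2 : f (trunc x n) @[n --> \oo] --> <[ x, Ell2 cS ]>.
  under eq_fun do rewrite ftrunc.
  exact: (@is_cvg_ell2_inner R x (Ell2 cS)).
by rewrite -[LHS](cvg_lim _ h1)// (cvg_lim _ h2).
Qed.

Lemma ell2_adjointP (x : ell2 R) (y : Y) :
  <[ K x, y ]> = <[ x, adjoint K y ]>.
Proof.
rewrite /adjoint; case: xgetP => [z _ -> //|].
by have [z Kz] := ell2_adjoint_exists y => /(_ z).
Qed.

End ell2_adjoint.

(* x stands for the family of regularized solutions, indexed by the
   regularization parameter. *)
Definition heuristic_quotient (R : realType) (V W : normedModType R)
    (K : V -> W) (y : W) (x : R -> V) (alpha : R) : R :=
  `|K (x alpha) - y| ^+ 2 / alpha.

(* Main.v *)
(* Let xi = K^* w.  As xi is in ell^2, there is n such that xdag vanishes and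
   |xi_k| <= 1/2 for k >= n.  The subgradient inequality, tested with the
   truncation of x to its first n coordinates, shows that the Bregman distance
   l1norm x - l1norm xdag - <xi, x - xdag> is at least half the l1 norm of the
   tail of x.  With r = |K x_alpha - ydelta| and t the l1 norm of the tail of
   x_alpha, minimality of x_alpha then gives
     r^2 + alpha t <= delta^2 + 2 alpha |w| (r + delta).
   Dropping alpha t yields r <= delta + 2 alpha |w|, so that the heuristic
   quotient at an alpha proportional to delta, hence also at alphas, is O(delta);
   dropping r^2 at alphas, where delta^2 / alphas is (delta / deltas)^2 times
   that quotient, bounds t.  The first n coordinates of x_alphas - xdag are
   controlled by K, because K is injective on their span. *)
Require Import Defs.
From mathcomp Require Import all_boot all_order all_algebra.
From mathcomp Require Import all_classical all_reals all_analysis.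
From mathcomp Require Import ring lra.

Set Implicit Arguments.
Unset Strict Implicit.
Unset Printing Implicit Defensive.

Import Order.TTheory GRing.Theory Num.Theory.
Import numFieldNormedType.Exports.

Local Open Scope classical_set_scope.
Local Open Scope ring_scope.

(** * Coefficient bounds for free families *)

(** The Gram matrix [G] is invertible: if [a *m G = 0], the combination with coefficients [a] is
    orthogonal to every [b i], hence to itself. So [invmx G] recovers the coefficients from the
    inner products with the [b j], which Cauchy-Schwarz bounds. *)
Lemma free_family_lower_bound (R : realType) (V : innerProductType R) n
    (b : 'I_n -> V) :
  (forall a : 'rV[R]_n, \sum_i a 0 i *: b i = 0 -> a = 0) ->
  exists2 c : R, 0 <= c &
    forall a : 'rV[R]_n, \sum_i `|a 0 i| <= c * `|\sum_i a 0 i *: b i|.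
Proof.
move=> b_free; pose G : 'M[R]_n := \matrix_(i, j) <[ b i, b j ]>.
have GE (a : 'rV_n) j : (a *m G) 0 j = <[ \sum_i a 0 i *: b i, b j ]>.
  by rewrite !mxE inner_suml; apply: eq_bigr => i _; rewrite innerZl mxE.
have uG : G \in unitmx.
  rewrite -row_free_unit; apply: inj_row_free => a aG0; apply: b_free.
  apply/eqP; rewrite -normr_eq0 -sqrf_eq0 -innerE inner_suml.
  rewrite big1// => i _.
  by rewrite innerZl innerC -GE aG0 mxE mulr0.
exists (\sum_i \sum_j `|b j| * `|invmx G j i|) => [|a].
  by apply: sumr_ge0 => i _; apply: sumr_ge0 => j _; rewrite mulr_ge0.
rewrite mulr_suml; apply: ler_sum => i _.
rewrite -{1}(mulmxK uG a) mxE mulr_suml; apply: le_trans (ler_norm_sum _ _ _) _.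
apply: ler_sum => j _; rewrite GE normrM mulrAC ler_wpM2r// mulrC.
exact: inner_CauchySchwarz.
Qed.

(** * The l1 norm against the norm and inner product of [ell2] *)

Lemma ell2_norm_le_sum (R : realType) (u : ell2 R) (L : R) :
  (forall n, \sum_(0 <= k < n) `|u k| <= L) -> `|u| <= L.
Proof.
move=> uL; have L0 : 0 <= L by have := uL 0; rewrite big_nil.
rewrite -(@ler_pXn2r _ 2)// ?nnegrE// -ell2_innerE_norm.
have [|_] := @square_summable_le R u (L ^+ 2); last exact.
(* Expanding the square of the sum of moduli leaves nonnegative cross terms. *)
move=> n; apply: le_trans (_ : (\sum_(0 <= k < n) `|u k|) ^+ 2 <= _); last first.
  by rewrite ler_pXn2r ?nnegrE// sumr_ge0.
elim: n => [|n ih]; first by rewrite !big_nil expr0n.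
rewrite !big_nat_recr//= sqrrD -[u n ^+ 2](real_normK (num_real _)) lerD2r.
apply: le_trans ih _; rewrite lerDl mulrn_wge0// mulr_ge0//.
exact: sumr_ge0.
Qed.

Section l1norm_theory.
Context {R : realType}.
Implicit Types x u v : ell2 R.
Local Open Scope ereal_scope.

Lemma l1norm_ge0 x : 0 <= l1norm x.
Proof. by apply: nneseries_ge0 => k _ _; rewrite lee_fin. Qed.

Lemma l1normN x : l1norm (- x)%R = l1norm x.
Proof. by apply: eq_eseriesr => k _; rewrite ell2NE normrN. Qed.

Lemma l1norm_sum_le x n : (\sum_(0 <= k < n) `|x k|)%:E <= l1norm x.
Proof.
by rewrite -sumEFin; apply: nneseries_lim_ge => k _ _; rewrite lee_fin.
Qed.

Lemma l1norm_finite x n : (forall k, (n <= k)%N -> x k = 0%R) ->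
  l1norm x = (\sum_(0 <= k < n) `|x k|)%:E.
Proof.
move=> xn; rewrite /l1norm (@nneseries_split _ _ 0 n)//.
by rewrite add0n sumEFin eseries0 ?adde0// => k nk _; rewrite xn// normr0.
Qed.

Lemma l1normD_disjoint u v : (forall k, u k = 0%R \/ v k = 0%R) ->
  l1norm (u + v)%R = l1norm u + l1norm v.
Proof.
move=> uv; rewrite /l1norm -nneseriesD; try by move=> *; rewrite lee_fin.
apply: eq_eseriesr => k _; rewrite ell2DE -EFinD.
by have [->|->] := uv k; rewrite normr0 ?add0r ?addr0.
Qed.

Lemma ell2_norm_le_l1norm x : `|x|%:E <= l1norm x.
Proof.
have := l1norm_sum_le x; case: (l1norm x) (l1norm_ge0 x) => [L _ xL|_ _|//].
  by rewrite lee_fin ell2_norm_le_sum.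
exact: leey.
Qed.

(** Hölder's inequality with [u] bounded only on the support of [v]: it serves for [v] a tail, where
    only late coordinates of [u] are known to be small. *)
Lemma inner_le_l1norm (c t : R) u v : (0 <= c)%R -> l1norm v = t%:E ->
  (forall k, `|u k| <= c \/ v k = 0)%R -> (<[ u, v ]> <= c * t)%R.
Proof.
move=> c0 vt uc; rewrite -[leLHS]/(limn (series (fun k => u k * v k))%R).
apply: limr_le; first exact: is_cvg_ell2_inner.
apply: nearW => n; apply: (@le_trans _ _ (c * \sum_(0 <= k < n) `|v k|)%R).
  rewrite mulr_sumr; apply: ler_sum => k _.
  have [uk|->] := uc k; last by rewrite normr0 !mulr0.
  by apply: le_trans (ler_norm _) _; rewrite normrM ler_wpM2r.
by rewrite ler_wpM2l// -lee_fin -vt l1norm_sum_le.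
Qed.

End l1norm_theory.

(** * Truncation to finitely many coordinates *)

Section ell2_truncation.
Context {R : realType}.
Implicit Types x : ell2 R.

Lemma square_summable_indic i : (fun k => (k == i)%:R) \in @square_summable R.
Proof.
suff /square_summable_le[] : forall n,
  \sum_(0 <= k < n) ((k == i)%:R : R) ^+ 2 <= 1 by [].
move=> n; rewrite big_mkord; under eq_bigr do rewrite -natrX.
rewrite -natr_sum lern1; have [ni|lt_in] := leqP n i.
  by rewrite big1// => k _; rewrite ltn_eqF// (leq_trans _ ni).
rewrite (bigD1 (Ordinal lt_in))//= eqxx big1// => k.
by rewrite -val_eqE => /negPf /= ->.
Qed.

Definition ell2_basis i : ell2 R := Ell2 (square_summable_indic i).

Lemma ell2_basisE i k : ell2_basis i k = (k == i)%:R.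
Proof. by []. Qed.

Definition ell2_comb n (a : 'rV[R]_n) : ell2 R := \sum_i a 0 i *: ell2_basis i.

Lemma ell2_sumE (I : Type) (r : seq I) (P : pred I) (F : I -> ell2 R) k :
  (\sum_(i <- r | P i) F i) k = \sum_(i <- r | P i) F i k.
Proof. by apply: (big_morph (fun u : ell2 R => u k)). Qed.

Lemma ell2_comb_ord n (a : 'rV[R]_n) (i : 'I_n) : ell2_comb a i = a 0 i.
Proof.
rewrite ell2_sumE (bigD1 i isT) ell2ZE ell2_basisE eqxx mulr1 big1 => [|j ji]; first by rewrite /= addr0.
by rewrite ell2ZE ell2_basisE val_eqE eq_sym (negPf ji) mulr0.
Qed.

Lemma ell2_comb_ge n (a : 'rV[R]_n) k : (n <= k)%N -> ell2_comb a k = 0.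
Proof.
move=> nk; rewrite ell2_sumE big1// => i _.
by rewrite ell2ZE ell2_basisE gtn_eqF ?mulr0// (leq_trans _ nk).
Qed.

Lemma finitely_supported_comb n (a : 'rV[R]_n) :
  finitely_supported (ell2_comb a).
Proof.
apply: sub_finite_set (finite_II n) => k /= ak.
by rewrite ltnNge; apply: contra_neqN ak => /ell2_comb_ge.
Qed.

(** Written as a combination of basis vectors, so that its image under [K] is a combination of the
    [K (ell2_basis i)]. *)
Definition ell2_head n x := ell2_comb (\row_(i < n) x i).

Lemma ell2_headE n x k : ell2_head n x k = if (k < n)%N then x k else 0.
Proof.
case: ltnP => [kn|/ell2_comb_ge -> //].
by rewrite -[k]/(nat_of_ord (Ordinal kn)) ell2_comb_ord mxE.
Qed.

Lemma l1norm_head n x :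
  l1norm (ell2_head n x) = (\sum_(0 <= k < n) `|x k|)%:E.
Proof.
rewrite (@l1norm_finite _ _ n) => [|k nk]; last by rewrite ell2_comb_ge.
by congr EFin; apply: eq_big_nat => k /andP[_ kn]; rewrite ell2_headE kn.
Qed.

Lemma l1norm_head_tail n x :
  (l1norm x = l1norm (ell2_head n x) + l1norm (x - ell2_head n x)%R)%E.
Proof.
rewrite -l1normD_disjoint ?subrKC// => k; rewrite ell2BE ell2_headE.
by case: ifP; [right; rewrite subrr|left].
Qed.

Lemma ell2_headB n x y : ell2_head n (x - y) = ell2_head n x - ell2_head n y.
Proof.
by apply: ell2P => k; rewrite !(ell2BE, ell2_headE); case: ifP; rewrite ?subr0.
Qed.

Lemma ell2_head_id n x : (forall k, (n <= k)%N -> x k = 0) -> ell2_head n x = x.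
Proof.
by move=> xn; apply: ell2P => k; rewrite ell2_headE; case: ltnP => // /xn.
Qed.

Lemma finitely_supported_bounded x :
  finitely_supported x -> exists n, forall k, (n <= k)%N -> x k = 0.
Proof.
move=> /finite_seqP[s xs]; exists (\max_(i <- s) i.+1)%N => k sk.
apply: contraTeq sk => xk; rewrite -ltnNge.
have ks : k \in s by have : [set` s] k by rewrite -xs.
exact: (@leq_bigmax_seq _ s xpredT succn).
Qed.

Lemma ell2_coord_cvg0 x : (x k @[k --> \oo] --> (0 : R))%classic.
Proof.
have /square_summableP/cvg_series_cvg_0/cvgrPdist_lt x0 := ell2_valP x.
apply/cvgrPdist_lt => e e0; have := x0 (e ^+ 2) (exprn_gt0 2 e0).
apply: filterS => k; rewrite !sub0r !normrN normrX.
by rewrite ltr_pXn2r ?nnegrE// ltW.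
Qed.

End ell2_truncation.

(** * Control of the head by [K] and of the tail by minimality *)

(** Finite basis injectivity makes the first [n] images [K (ell2_basis i)] a free family. *)
Lemma finite_basis_injective_lower_bound (R : realType)
    (Y : innerProductType R) (K : {linear ell2 R -> Y}) n :
  finite_basis_injective K ->
  exists2 c : R, 0 <= c &
    forall x : ell2 R, \sum_(0 <= k < n) `|x k| <= c * `|K (ell2_head n x)|.
Proof.
move=> K_fbi.
have Kcomb (a : 'rV[R]_n) :
    K (ell2_comb a) = \sum_i a 0 i *: K (ell2_basis i).
  by rewrite linear_sum; apply: eq_bigr => i _; rewrite linearZ.
have [a|c c0 cP] := @free_family_lower_bound R Y n (fun i => K (ell2_basis i)).
  rewrite -Kcomb -(linear0 K) => /K_fbi a0.
  have {}a0 : ell2_comb a = 0.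
    apply: a0; first exact: finitely_supported_comb.
    have <- : ell2_comb (0 : 'rV[R]_0) = 0 by rewrite /ell2_comb big_ord0.
    exact: finitely_supported_comb.
  by apply/rowP => i; rewrite -ell2_comb_ord a0 mxE.
exists c => // x; have := cP (\row_(i < n) x i); rewrite -Kcomb big_mkord.
by under eq_bigr do rewrite mxE.
Qed.

Lemma tikhonov_tail (R : realType) (Y : innerProductType R)
    (K : {linear ell2 R -> Y}) (w y : Y) (xdag x : ell2 R) n (alpha delta : R) :
  bounded_operator K ->
  subdifferential l1norm xdag (adjoint K w) ->
  (forall k, (n <= k)%N -> xdag k = 0) ->
  (forall k, (n <= k)%N -> `|adjoint K w k| <= 2^-1) ->
  `|K xdag - y| <= delta -> 0 < alpha ->
  is_minimizer (tikhonov K l1norm y alpha) x ->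
  exists2 t : R, l1norm (x - ell2_head n x) = t%:E &
    `|K x - y| ^+ 2 + alpha * t
      <= delta ^+ 2 + 2 * alpha * `|w| * (`|K x - y| + delta).
Proof.
move=> K_bounded [xdag_fin xi_sub] xdag_n xi_n ydelta alpha0 x_min.
set xi := adjoint K w in xi_sub xi_n.
have := xi_sub (ell2_head n x); have := x_min xdag.
rewrite /tikhonov (l1norm_head_tail n x) l1norm_head -(fineK xdag_fin).
set L := fine _; set H := \sum_(0 <= k < n) _.
have := l1norm_ge0 (x - ell2_head n x).
move tE : (l1norm (x - _)) => T; case: T tE => [t tE _|_ _|//]; last first.
  (* A tail of infinite norm would make the Tikhonov functional infinite at [x], although it is
     finite at [xdag]. *)
  by rewrite addey// gt0_muley ?lte_fin// addey.
rewrite -!EFinD !lee_fin => minR subR; exists t => //.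
have xi_tail : <[ xi, x - ell2_head n x ]> <= 2^-1 * t.
  apply: (inner_le_l1norm _ tE) => // k.
  rewrite ell2BE ell2_headE; case: ltnP => [_|/xi_n]; last by left.
  by right; rewrite subrr.
have xiK : - <[ xi, x - xdag ]> <= `|w| * (`|K x - y| + delta).
  rewrite (innerC xi) -ell2_adjointP// -innerNl innerC.
  apply: le_trans (ler_norm _) _; apply: le_trans (inner_CauchySchwarz _ _) _.
  rewrite ler_wpM2l// normrN linearB -(subrKA y).
  apply: le_trans (ler_normD _ _) _.
  by rewrite lerD2l distrC.
have subE : <[ xi, ell2_head n x - xdag ]> =
    <[ xi, x - xdag ]> - <[ xi, x - ell2_head n x ]>.
  by rewrite -innerBr opprB [in RHS]addrC subrKA.
rewrite subE in subR.
have d2 : `|K xdag - y| ^+ 2 <= delta ^+ 2.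
  by rewrite ler_pXn2r ?nnegrE// (le_trans _ ydelta).
(* One half of [t] absorbs the pairing of [xi] with the tail; the other half, once the minimality
   inequality is doubled, yields [alpha * t]. *)
have : alpha * (H + 2^-1 * t - L) >= - (alpha * (`|w| * (`|K x - y| + delta))).
  by rewrite -mulrN ler_pM2l//; lra.
by lra.
Qed.

(** * The error bound for the heuristic parameter choice *)

Theorem theorem3p3 (R : realType) (Y : hilbertType R)
  (K : {linear ell2 R -> Y}) (K_bounded : bounded_operator K)
  (ydag : Y) (xdag : ell2 R)
  (xdag_min : min_solution K l1norm ydag xdag)
  (xdag_finite : finitely_supported xdag)
  (source : exists w : Y, subdifferential l1norm xdag (adjoint K w))
  (K_fbi : finite_basis_injective K)
  (delta0 : R) (delta0_gt0 : 0 < delta0) :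
  exists2 C : R, 0 < C &
    forall (delta : R) (ydelta : Y),
      0 < delta <= delta0 -> `|ydag - ydelta| <= delta ->
    forall x : R -> ell2 R,
      (forall alpha : R, 0 < alpha ->
         is_minimizer (tikhonov K l1norm ydelta alpha) (x alpha)) ->
    forall alphas : R,
      0 < alphas <= opnorm K ^+ 2 ->
      (forall alpha : R, 0 < alpha <= opnorm K ^+ 2 ->
         heuristic_quotient K ydelta x alphas
           <= heuristic_quotient K ydelta x alpha) ->
    let deltas := `|K (x alphas) - ydelta| in
      deltas != 0 ->
      (l1norm (xdag - x alphas)%R
         <= (C * (1 + (delta / deltas) ^+ 2) * Num.max deltas delta)%:E)%E.
Proof.
have [w xi_sub] := source; have [Kxdag _ _] := xdag_min.
(* In the first case no [alphas] is admissible. *)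
have [B0|B0] := leP (opnorm K ^+ 2) 0.
  exists 1 => // delta ydelta _ _ x _ alphas /andP[alphas0].
  by move=> /(lt_le_trans alphas0)/lt_le_trans/(_ B0); rewrite ltxx.
set B := opnorm K ^+ 2 in B0 *.
have [M0 KM0] := K_bounded; pose M := `|M0|.
have KM u : `|K u| <= M * `|u|.
  by apply: le_trans (KM0 u) _; rewrite ler_wpM2r// ler_norm.
have [n1 xdag_n1] := finitely_supported_bounded xdag_finite.
have [n [xdag_n xi_n]] : exists n,
    (forall k, (n <= k)%N -> xdag k = 0) /\
    (forall k, (n <= k)%N -> `|adjoint K w k| <= 2^-1).
  have /cvgrPdist_le/(_ 2^-1) := ell2_coord_cvg0 (adjoint K w).
  case=> [//|n2 _ xi_n2]; exists (maxn n1 n2).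
  split=> k; rewrite geq_max => /andP[nk1 nk2]; first exact: xdag_n1.
  by have := xi_n2 k nk2; rewrite /= sub0r normrN.
have [c c0 cP] := finite_basis_injective_lower_bound n K_fbi.
(* The comparison parameter will be [g * delta]: [g <= B / delta0] makes it admissible for all
   [delta <= delta0], and [g <= 1] bounds its residual by [(1 + 2 * W) * delta]. *)
pose W := `|w|; pose g := Num.min 1 (B / delta0).
have g0 : 0 < g by rewrite lt_min ltr01 divr_gt0.
have M_ge0 : 0 <= M := normr_ge0 _.
have W_ge0 : 0 <= W := normr_ge0 _.
pose A := (1 + 2 * W) ^+ 2 / g.
have A_ge0 : 0 <= A by rewrite divr_ge0 ?sqr_ge0 ?ltW.
(* [2 * c] comes from the residuals in the head estimate, [c * M + 1] counts the tail within that
   estimate and by itself, and [A + 4 * W] bounds the tail. Below, [D + 1] secures positivity. *)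
pose D := 2 * c + (c * M + 1) * (A + 4 * W).
have AW_ge0 : 0 <= A + 4 * W by rewrite (addr_ge0 A_ge0)// mulr_ge0.
have cM_ge0 : 0 <= c * M + 1 by rewrite addr_ge0// mulr_ge0.
have D_ge0 : 0 <= D.
  by rewrite (addr_ge0 _ (mulr_ge0 cM_ge0 AW_ge0))// mulr_ge0.
exists (D + 1); first by rewrite ltr_wpDl.
move=> delta y /andP[delta_gt0 delta_le] ydelta x x_min alphas /andP[as0 asB].
move=> as_min; set d := `| _ - y|; move=> /= d0.
have d_gt0 : 0 < d by rewrite lt_neqAle eq_sym d0 normr_ge0.
rewrite -Kxdag in ydelta.
have tail a a0 :=
  tikhonov_tail K_bounded xi_sub xdag_n xi_n ydelta a0 (x_min a a0).
have [ga0 gaB] : 0 < g * delta /\ g * delta <= B.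
  split; first by rewrite mulr_gt0.
  apply: le_trans (_ : B / delta0 * delta0 <= _); last by rewrite divfK ?gt_eqF.
  by rewrite ler_pM ?(ltW g0) ?(ltW delta_gt0)// ge_min lexx orbT.
have g1 : g <= 1 by rewrite ge_min lexx.
have quot : d ^+ 2 / alphas <= A * delta.
  have := as_min (g * delta); rewrite ga0 gaB => /(_ isT)/le_trans; apply.
  rewrite /heuristic_quotient; have [t tE] := tail _ ga0.
  set r := `|K _ - y| => rt.
  have t0 : 0 <= t by rewrite -lee_fin -tE l1norm_ge0.
  have r0 : 0 <= r := normr_ge0 _.
  have r_le : r <= (1 + 2 * W) * delta.
    (* Factoring [r ^+ 2 - delta ^+ 2] lets the positive [r + delta] cancel. *)
    have : (r - delta) * (r + delta) <= (2 * (g * delta) * W) * (r + delta).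
      rewrite -/W in rt.
      have : 0 <= g * delta * t by rewrite mulr_ge0 ?(ltW ga0).
      by rewrite -subr_sqr; lra.
    rewrite ler_pM2r; last by rewrite ltr_wpDl.
    have : g * (delta * W) <= 1 * (delta * W).
      by rewrite ler_wpM2r// mulr_ge0 ?(ltW delta_gt0).
    by lra.
  rewrite ler_pdivrMr//.
  rewrite (_ : A * delta * (g * delta) = ((1 + 2 * W) * delta) ^+ 2).
    by rewrite ler_pXn2r// nnegrE// (le_trans r0).
  by rewrite /A; field; rewrite gt_eqF.
have [t tE] := tail _ as0; rewrite -/d -/W => dt.
have t0 : 0 <= t by rewrite -lee_fin -tE l1norm_ge0.
set q := (delta / d) ^+ 2.
have q0 : 0 <= q by rewrite sqr_ge0.
have t_le : t <= q * (A * delta) + 2 * W * (d + delta).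
  have : alphas * t <= alphas * (delta ^+ 2 / alphas + 2 * W * (d + delta)).
    rewrite mulrDr [alphas * (_ / _)]mulrC divfK ?gt_eqF//.
    by have := sqr_ge0 d; lra.
  rewrite ler_pM2l// => /le_trans; apply; rewrite lerD2r.
  rewrite (_ : delta ^+ 2 / alphas = q * (d ^+ 2 / alphas)); last first.
    by rewrite /q expr_div_n mulrA divfK ?sqrf_eq0.
  by rewrite ler_wpM2l.
(* As [xdag] is its own head, the tails of the error and of [x alphas] differ by a sign. *)
have tailE : l1norm ((xdag - x alphas) - ell2_head n (xdag - x alphas)) = t%:E.
  rewrite -tE -l1normN ell2_headB (ell2_head_id xdag_n).
  by congr l1norm; rewrite !opprB addrC subrKA.
rewrite (l1norm_head_tail n) l1norm_head tailE -EFinD lee_fin.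
set e := xdag - x alphas in tailE *.
have e_tail : `|e - ell2_head n e| <= t.
  by rewrite -lee_fin -tailE ell2_norm_le_l1norm.
(* The head of [e] is [e] minus its tail: [K e] has norm at most [d + delta], and [K] of the tail at
   most [M * t]. *)
have e_head : \sum_(0 <= k < n) `|e k| <= c * (d + delta + M * t).
  apply: le_trans (cP e) _; rewrite ler_wpM2l//.
  rewrite -[ell2_head n e](subKr e) linearB.
  apply: le_trans (ler_normB _ _) _; apply: lerD; last first.
    by apply: le_trans (KM _) _; rewrite ler_wpM2l.
  rewrite /e linearB -(subrKA y) [d + _]addrC; apply: le_trans (ler_normD _ _) _.
  by rewrite lerD// distrC.
set m := Num.max d delta.
have [dm deltam] : d <= m /\ delta <= m by rewrite !le_max !lexx orbT.
have m0 : 0 <= m by exact: le_trans (ltW d_gt0) dm.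
apply: le_trans (_ : D * (1 + q) * m <= _); last first.
  by rewrite !ler_wpM2r ?addr_ge0// lerDl.
(* Since [q] and [m] are nonnegative, [m] and [q * m] are both at most the common factor
   [(1 + q) * m]. *)
have t_le' : t <= (A + 4 * W) * ((1 + q) * m).
  apply: le_trans t_le _.
  have h1 : q * (A * delta) <= A * ((1 + q) * m).
    rewrite mulrCA (ler_wpM2l A_ge0)// (ler_pM q0 (ltW delta_gt0))//.
    by rewrite lerDr.
  have h2 : W * (d + delta) <= W * (2 * ((1 + q) * m)).
    by rewrite ler_wpM2l//; have := mulr_ge0 q0 m0; lra.
  by lra.
have h3 : c * (d + delta) <= c * (2 * ((1 + q) * m)).
  by rewrite ler_wpM2l//; have := mulr_ge0 q0 m0; lra.
have h4 : (c * M + 1) * t <= (c * M + 1) * ((A + 4 * W) * ((1 + q) * m)).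
  by rewrite ler_wpM2l// addr_ge0 ?mulr_ge0.
by rewrite /D; lra.
Qed.
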